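(* Let $Y$ be a (real or complex) infinite-dimensional Banach space. Then there exists a closed, absolutely convex subset of $B_Y$ which is not remotal from $0$.
   Context: $B_Y$ is the closed unit ball of $Y$. A set is absolutely convex if it is convex and equilibrated (i.e. closed under multiplication by scalars of modulus at most $1$). A bounded subset $E$ of a Banach space $Y$ is remotal from $x\in Y$ if there is $e_x\in E$ such that $\|x-e_x\|=\sup\{\|x-e\|:e\in E\}$. Absolutely convex sets are understood to be nonempty. *)

(* Defs.v *)
From HB Require Import structures.
From mathcomp Require Import all_boot all_order all_algebra.
From mathcomp Require Import complex.
From mathcomp Require Import all_classical all_reals all_analysis.

Set Implicit Arguments.
Unset Strict Implicit.
Unset Printing Implicit Defensive.

Import Order.TTheory GRing.Theory Num.Theory.
Import numFieldNormedType.Exports.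

Local Open Scope classical_set_scope.
Local Open Scope ring_scope.

Definition finite_dimensional (K : numFieldType) (Y : lmodType K) : Prop :=
  exists (n : nat) (b : 'I_n -> Y),
    forall y : Y, exists c : 'I_n -> K, y = \sum_(i < n) c i *: b i.

Definition infinite_dimensional (K : numFieldType) (Y : lmodType K) : Prop :=
  ~ finite_dimensional Y.

Definition closed_unit_ball (K : numFieldType) (Y : normedModType K) : set Y :=
  [set y | `|y| <= 1].

Definition equilibrated (K : numFieldType) (Y : lmodType K) (C : set Y) : Prop :=
  forall (a : K) (y : Y), `|a| <= 1 -> C y -> C (a *: y).

(* Over K = R[i] the weights in [convex_set] are the k : K with 0 <= k <= 1,
   hence real: the order of R[i] only compares numbers with the same imaginary
   part. *)
Definition absolutely_convex (K : numFieldType) (Y : lmodType K)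
    (C : set Y) : Prop :=
  [/\ C !=set0, convex_set C & equilibrated C].

(* [supremums A s] says that s is the least upper bound of A. Norms are valued
   in K itself; for K = R[i] and E nonempty, an upper bound in K of a set of
   norms is comparable with a real, so it is real, and the least upper bound is
   the one computed in R. *)
Definition remotal (K : numFieldType) (Y : normedModType K)
    (E : set Y) (x : Y) : Prop :=
  exists2 e, E e & supremums [set `|x - y| | y in E] `|x - e|.

(* Main.v *)
(* If q is a continuous norm on a closed subspace E of Y that is strictly
   weaker than the norm of Y, then C = {y in E : |y| + q y <= 1} is not remotal
   from 0: q > 0 off 0 forces |y| < 1 on C, whereas unit vectors y with q y
   arbitrarily small give sup_C |y| = 1.  Take for E the closed span of a linearly
   independent sequence and q y = sup_n |f_n y| / (n + 1), where f_n is a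
   Hahn-Banach functional norming the n-th term of a sequence whose closure
   contains E.  The f_n separate the points of E, and finitely many of them have
   a common zero other than 0 in E. *)
Require Import Defs.
From HB Require Import structures.
From mathcomp Require Import all_boot all_order all_algebra.
From mathcomp Require Import complex ring lra.
From mathcomp Require Import all_classical all_reals all_analysis.
Import Order.TTheory GRing.Theory Num.Theory.
Import numFieldNormedType.Exports.
Local Open Scope classical_set_scope.
Local Open Scope ring_scope.
Local Open Scope complex_scope.

(** * Hahn-Banach for sublinear maps, by minimality *)

(* [iota] embeds R into the scalars, so that complex spaces are covered without
   building the underlying real space. *)
Section HahnBanach.
Context {R : realType} {K : pzRingType} (iota : {rmorphism R -> K}).
Context {V : lmodType K}.
Implicit Types p q : V -> R.

Definition sublinear p :=
  (forall x y, p (x + y) <= p x + p y) /\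
  (forall t x, 0 < t -> p (iota t *: x) = t * p x).

Lemma sublinear0 p : sublinear p -> p 0 = 0.
Proof.
move=> [_ pZ]; have := pZ 2 0 ltac:(by []).
by rewrite scaler0 => p0; lra.
Qed.

(** This bound depends on [p] alone, so pointwise infima of sublinear maps below [p] are finite. *)
Lemma sublinear_ge p q x : sublinear q -> (forall y, q y <= p y) ->
  - p (- x) <= q x.
Proof.
move=> sq qp; have /(_ x (- x)) := sq.1; rewrite subrr sublinear0// => qD.
have := qp (- x); lra.
Qed.

Lemma inf_sublinear (F : set (V -> R)) (b : V -> R) :
  F !=set0 -> (forall h x, F h -> b x <= h x) ->
  (forall h k x y, F h -> F k -> exists2 l, F l & l (x + y) <= h x + k y) ->
  (forall h t x, 0 < t -> F h -> exists2 k, F k & k (iota t *: x) <= t * h x) ->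
  sublinear (fun x => inf [set h x | h in F]).
Proof.
move=> [h0 Fh0] Fb FD FZ.
have lbF x : has_lbound [set h x | h in F].
  by exists (b x) => _ [h Fh <-]; exact: Fb.
have infF x : has_inf [set h x | h in F] by split => //; exists (h0 x), h0.
have inf_le h x : F h -> inf [set h x | h in F] <= h x.
  by move=> Fh; apply: ge_inf => //; exists h.
split=> [x y|].
  apply/ler_addgt0Pr => e e0; have e20 : 0 < e / 2 by lra.
  have [_ [h Fh <-] hx] := inf_adherent e20 (infF x).
  have [_ [k Fk <-] ky] := inf_adherent e20 (infF y).
  have [l Fl lxy] := FD h k x y Fh Fk.
  have := inf_le l (x + y) Fl; lra.
have infZ t x : 0 < t ->
    inf [set h (iota t *: x) | h in F] <= t * inf [set h x | h in F].
  move=> t0; rewrite -ler_pdivrMl//; apply: lb_le_inf; first by exists (h0 x), h0.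
  move=> _ [h Fh <-]; rewrite ler_pdivrMl//.
  by have [k Fk] := FZ h t x t0 Fh; apply: le_trans; exact: inf_le.
move=> t x t0; apply/le_anti; rewrite infZ//=.
(* The reverse inequality is [infZ] for the scalar [t^-1] at the point [iota t *: x]. *)
have := infZ t^-1 (iota t *: x); rewrite invr_gt0 => /(_ t0).
by rewrite scalerA -rmorphM mulVf ?gt_eqF// rmorph1 scale1r ler_pdivlMl.
Qed.

(** Take [q x] to be the infimum of [p (x + t a) - t * p a] over [t >= 0]. Subadditivity bounds it
    below by [- p (- x)]; [t = 0] gives [q <= p], and [t = 1] at [x = - a] gives the last
    inequality. *)
Lemma sublinear_directional p a : sublinear p ->
  exists q, [/\ sublinear q, (forall x, q x <= p x) & q (- a) <= - p a].
Proof.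
move=> sp; have [pD pZ] := sp.
pose F : set (V -> R) :=
  [set h | exists2 t, 0 <= t & h = fun x => p (x + iota t *: a) - t * p a].
have pZ0 t x : 0 <= t -> p (iota t *: x) = t * p x.
  rewrite le_eqVlt => /predU1P[<-|]; last exact: pZ.
  by rewrite rmorph0 scale0r mul0r sublinear0.
have Fb h x : F h -> - p (- x) <= h x.
  move=> [t t0 ->]; rewrite -pZ0//.
  have := pD (x + iota t *: a) (- x); rewrite addrAC subrr add0r; lra.
have inf_le h x : F h -> inf [set h x | h in F] <= h x.
  by move=> Fh; apply: ge_inf; [exists (- p (- x)) => _ [k Fk <-]; exact: Fb|exists h].
exists (fun x => inf [set h x | h in F]); split.
- apply: inf_sublinear Fb _ _.
  + by exists (fun x => p (x + iota 0 *: a) - 0 * p a), 0.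
  + move=> _ _ x y [s s0 ->] [t t0 ->].
    exists (fun x => p (x + iota (s + t) *: a) - (s + t) * p a).
      by exists (s + t) => //; rewrite addr_ge0.
    rewrite rmorphD scalerDl addrACA mulrDl.
    have := pD (x + iota s *: a) (y + iota t *: a); lra.
  + move=> _ t x t0 [s s0 ->].
    exists (fun x => p (x + iota (t * s) *: a) - (t * s) * p a).
      by exists (t * s) => //; rewrite mulr_ge0// ltW.
    by rewrite rmorphM -scalerA -scalerDr pZ// mulrBr mulrA.
- move=> x; apply: le_trans (inf_le (fun x => p (x + iota 0 *: a) - 0 * p a) x _) _.
    by exists 0.
  by rewrite rmorph0 scale0r addr0 mul0r subr0.
- apply: le_trans (inf_le (fun x => p (x + iota 1 *: a) - 1 * p a) _ _) _.
    by exists 1.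
  by rewrite rmorph1 scale1r addNr sublinear0// mul1r sub0r.
Qed.

(** Zorn's lemma for the reversed pointwise order: a nonempty chain is bounded by its pointwise
    infimum, the empty one by [p]. *)
Lemma minimal_sublinear p : sublinear p ->
  exists q, [/\ sublinear q, (forall x, q x <= p x) &
    forall r, sublinear r -> (forall x, r x <= q x) -> r = q].
Proof.
move=> sp; pose T := {q : V -> R | sublinear q /\ forall x, q x <= p x}.
pose le (q r : T) := `[< forall x, sval r x <= sval q x >].
have [||||[q [sq qp]] qmin] := @Zorn T le.
- by move=> q; apply/asboolP.
- move=> q r s /asboolP qr /asboolP rs; apply/asboolP => x.
  exact: le_trans (qr x).
- move=> [q Pq] [r Pr] /asboolP/= qr /asboolP/= rq.
  apply: eq_exist; apply/funext => x; apply/le_anti.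
  by rewrite qr rq.
- move=> A totA; have [->|/set0P[q0 Aq0]] := eqVneq A set0.
    by exists (exist _ p (conj sp (fun=> lexx _))).
  pose F : set (V -> R) := [set sval q | q in A].
  have Fb h x : F h -> - p (- x) <= h x.
    by move=> [[q [sq qp]] Aq <-]; exact: sublinear_ge.
  have inf_le h x : F h -> inf [set h x | h in F] <= h x.
    move=> Fh; apply: ge_inf; last by exists h.
    by exists (- p (- x)) => _ [k Fk <-]; exact: Fb.
  have s_inf : sublinear (fun x => inf [set h x | h in F]).
    apply: inf_sublinear Fb _ _.
    + by exists (sval q0), q0.
    + move=> _ _ x y [q Aq <-] [r Ar <-].
      have [/asboolP qr|/asboolP rq] := totA q r Aq Ar.
      * exists (sval r); first by exists r.
        apply: le_trans ((svalP r).1.1 x y) _.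
        by rewrite lerD2r qr.
      * exists (sval q); first by exists q.
        apply: le_trans ((svalP q).1.1 x y) _.
        by rewrite lerD2l rq.
    + move=> _ t x t0 [q Aq <-]; exists (sval q); first by exists q.
      by rewrite (svalP q).1.2.
  have inf_p x : inf [set h x | h in F] <= p x.
    by apply: le_trans ((svalP q0).2 x); apply: inf_le; exists q0.
  exists (exist (fun q => sublinear q /\ forall x, q x <= p x) _
    (conj s_inf inf_p)) => q Aq; apply/asboolP => x /=.
  by apply: inf_le; exists q.
- exists q; split => // r sr rq.
  have rp x : r x <= p x := le_trans (rq x) (qp x).
  by have /(congr1 sval) := qmin (exist _ r (conj sr rp)) (asboolT rq).
Qed.

(* A minimal sublinear [q] is odd, because [sublinear_directional] cannot
   strictly lower it in any direction [a]; an odd sublinear map is linear. *)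
Lemma hahn_banach p a : sublinear p ->
  exists f : V -> R, [/\ (forall x y, f (x + y) = f x + f y),
    (forall t x, f (iota t *: x) = t * f x),
    (forall x, f x <= p x) & f a = p a].
Proof.
(* Lowering [p] in the direction [a] before minimizing secures [f a = p a]: then
   [- f a = f (- a) <= q (- a) <= - p a]. *)
move=> sp; have [q [sq qp qa]] := sublinear_directional _ a sp.
have [f [sf fq fmin]] := minimal_sublinear _ sq; have [fD fZ] := sf.
have fN x : f (- x) = - f x.
  have [r [sr rf rx]] := sublinear_directional _ x sf.
  rewrite (fmin r sr rf) in rx; apply/le_anti; rewrite rx /=.
  by have := fD x (- x); rewrite subrr sublinear0//; lra.
have fDE x y : f (x + y) = f x + f y.
  apply/le_anti; rewrite fD /=.
  by have := fD (- x) (- y); rewrite -opprD !fN; lra.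
exists f; split => //.
- move=> t x; have [t0|t0|<-] := ltgtP 0 t; first exact: fZ.
  + by have := fZ (- t) x; rewrite oppr_gt0 rmorphN scaleNr fN => /(_ t0); lra.
  + by rewrite rmorph0 scale0r mul0r sublinear0.
- by move=> x; exact: le_trans (fq x) (qp x).
- apply/le_anti/andP; split; first exact: le_trans (fq a) (qp a).
  by have := fq (- a); rewrite fN; lra.
Qed.

End HahnBanach.

(** * Independent sequences and common zeros of functionals *)

Lemma infinite_dimensional_free_seq (K : numFieldType) (Y : lmodType K) :
  infinite_dimensional Y -> exists x : nat -> Y,
    forall n (c : nat -> K), \sum_(i < n) c i *: x i = 0 ->
    forall i, (i < n)%N -> c i = 0.
Proof.
move=> infY.
(* No finite list spans [Y], so [g] picks a vector outside the span of each list; iterating [g]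
   builds the sequence. *)
have /choice[g gP] : forall s : seq Y, exists y, forall c : nat -> K,
    y <> \sum_(i < size s) c i *: s`_i.
  move=> s; apply: contrapT => /forallNP sY; apply: infY.
  exists (size s), (fun i => s`_i) => y.
  have /existsNP[c /contrapT ->] := sY y.
  by exists (fun i => c i).
pose L n := iter n (fun s => rcons s (g s)) [::].
pose x n := g (L n); exists x.
have LE n : L n = mkseq x n.
  by elim: n => //= n IH; rewrite mkseqS -IH.
have xn n (c : nat -> K) : x n <> \sum_(i < n) c i *: x i.
  have := gP (L n) c; rewrite -/(x n) LE size_mkseq => xn xE; apply: xn.
  by rewrite xE; apply: eq_bigr => i _; rewrite nth_mkseq.
elim=> [//|n IH] c; rewrite big_ord_recr /=.
have [cn0|cn0] := eqVneq (c n) 0.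
  rewrite cn0 scale0r addr0 => /IH ci i.
  by rewrite ltnS leq_eqVlt => /predU1P[->|/ci].
move=> /eqP; rewrite addr_eq0 => /eqP cx.
exfalso; apply: (xn n (fun i => - (c n)^-1 * c i)).
under eq_bigr do rewrite -scalerA.
rewrite -scaler_sumr cx scalerN scaleNr opprK scalerA mulVf//.
by rewrite scale1r.
Qed.

(** The matrix of [N] functionals on [N.+1] vectors has more rows than columns, hence a nonzero left
    kernel; freeness makes the resulting combination nonzero. *)
Lemma common_kernel (K : numFieldType) (Y : lmodType K) (x : nat -> Y)
    (f : nat -> {scalar Y}) N :
  (forall n (c : nat -> K), \sum_(i < n) c i *: x i = 0 ->
    forall i, (i < n)%N -> c i = 0) ->
  exists c : nat -> K, \sum_(i < N.+1) c i *: x i != 0 /\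
    forall n, (n < N)%N -> f n (\sum_(i < N.+1) c i *: x i) = 0.
Proof.
move=> free_x; pose A : 'M[K]_(N.+1, N) := \matrix_(i, j) f j (x i).
have /rowV0Pn[v /sub_kermxP vA v0] : kermx A != 0.
  by rewrite -mxrank_eq0 mxrank_ker subn_eq0 -ltnNge ltnS rank_leq_col.
pose c i := v 0 (inord i); exists c; split.
  apply: contra v0 => /eqP/free_x c0; apply/eqP/rowP => i.
  by rewrite mxE -(c0 i)// /c inord_val.
move=> n nN; move/rowP: vA => /(_ (Ordinal nN)); rewrite !mxE => vA.
rewrite linear_sum /= -[RHS]vA; apply: eq_bigr => i _.
by rewrite linearZ /= mxE /c inord_val.
Qed.

(** * Closures in normed spaces *)

Lemma closure_normP (K : numFieldType) (Y : normedModType K) (A : set Y) y :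
  closure A y <-> forall e : K, 0 < e -> exists2 z, A z & `|y - z| < e.
Proof.
split=> [clA e e0|clA B].
  have /clA[z [Az]] : nbhs y (ball y e) by exact: nbhsx_ballx.
  by rewrite -ball_normE; exists z.
move=> /nbhs_normP[e /= e0 eB]; have [z Az yz] := clA e e0.
by exists z; split => //; exact: eB.
Qed.

Lemma closure_linear_closed (K : numFieldType) (Y : normedModType K)
    (A : set Y) :
  (forall a y z, A y -> A z -> A (a *: y + z)) ->
  forall a y z, closure A y -> closure A z -> closure A (a *: y + z).
Proof.
move=> Alin a y z /closure_normP cy /closure_normP cz; apply/closure_normP => e e0.
(* Dividing by [|a| + 1] instead of [|a|] covers [a = 0]. *)
have a1 : 0 < `|a| + 1 by rewrite ltr_wpDl.
have e2 : 0 < e / 2 by rewrite divr_gt0.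
have [y' Ay yy'] := cy _ (divr_gt0 e2 a1).
have [z' Az zz'] := cz _ e2.
exists (a *: y' + z'); first exact: Alin.
rewrite opprD addrACA -scalerBr (le_lt_trans (ler_normD _ _))//.
rewrite [ltRHS]splitr ltrD// normrZ.
rewrite (le_lt_trans (_ : _ <= `|y - y'| * (`|a| + 1)))//.
  by rewrite mulrDr mulr1 mulrC lerDl.
by rewrite -ltr_pdivlMr.
Qed.

(** * The non-remotal set, over an abstract scalar field *)

Section NonRemotal.
Context {K : numFieldType} {Y : normedModType K}.
Variables (x : nat -> Y) (f : nat -> {scalar Y}) (d : nat -> Y).

Let S : set Y := [set y | exists n (c : nat -> K), y = \sum_(i < n) c i *: x i].

(** One norm per [n], each between [|y|] and [2 |y|]. Requiring [p n y <= 1] for all [n] expresses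
    the bound on [|y| + q y] without forming a supremum in [K]. *)
Let p n y : K := `|y| + n.+1%:R^-1 * `|f n y|.

Let C : set Y := closure S `&` [set y | forall n, p n y <= 1].

Hypothesis free_x : forall n (c : nat -> K), \sum_(i < n) c i *: x i = 0 ->
    forall i, (i < n)%N -> c i = 0.
Hypothesis f_le : forall n y, `|f n y| <= `|y|.
Hypothesis f_norming : forall n, `|f n (d n)| = `|d n|.
Hypothesis d_dense : forall y (e : K), S y -> 0 < e -> exists n, `|y - d n| < e.
Hypothesis archiK : forall e : K, 0 < e -> exists n, n.+1%:R^-1 < e.

Let w_ge0 n : 0 <= n.+1%:R^-1 :> K.
Proof. by rewrite invr_ge0. Qed.

Let pD n y z : p n (y + z) <= p n y + p n z.
Proof.
rewrite /p linearD addrACA -mulrDr lerD ?ler_normD//.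
by rewrite ler_wpM2l// ler_normD.
Qed.

Let pZ n a y : p n (a *: y) = `|a| * p n y.
Proof. by rewrite /p linearZ /= normrM normrZ mulrDr [in RHS]mulrCA. Qed.

Let p_ge n y : `|y| <= p n y.
Proof. by rewrite lerDl mulr_ge0. Qed.

Let p_le n y : p n y <= `|y| *+ 2.
Proof.
rewrite mulr2n lerD// -[leRHS]mul1r ler_pM//.
by rewrite invf_le1 ?ler1n.
Qed.

Let S_linear a y z : S y -> S z -> S (a *: y + z).
Proof.
move=> [m [b ->]] [n [c ->]].
have pad k (u : nat -> K) : (k <= maxn m n)%N -> \sum_(i < k) u i *: x i =
    \sum_(i < maxn m n) (if (i < k)%N then u i else 0) *: x i.
  move=> km; rewrite (big_ord_widen _ (fun i => u i *: x i) km) big_mkcond /=.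
  by apply: eq_bigr => i _; case: ifP; rewrite ?scale0r.
exists (maxn m n), (fun i => a * (if (i < m)%N then b i else 0) +
  (if (i < n)%N then c i else 0)).
rewrite (pad m) ?leq_maxl// (pad n) ?leq_maxr// scaler_sumr -big_split /=.
by apply: eq_bigr => i _; rewrite scalerDl scalerA.
Qed.

Let closureS_linear := closure_linear_closed _ _ _ S_linear.

Let closureS0 : closure S 0.
Proof. by apply: subset_closure; exists 0%N, (fun=> 0); rewrite big_ord0. Qed.

Let closureSZ a y : closure S y -> closure S (a *: y).
Proof. by move=> Sy; rewrite -[_ *: _]addr0; exact: closureS_linear. Qed.

(** Choose [d n] within [|y| / 2] of [y]. If [f n y = 0], then [|d n| = |f n (d n - y)| <= |d n - y|
    < |y| / 2], and the triangle inequality yields [|y| < |y|]. *)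
Lemma functionals_total y : closure S y -> (forall n, f n y = 0) -> y = 0.
Proof.
move=> /closure_normP Sy fy0; apply/eqP; apply: contraT => y0.
have e0 : 0 < `|y| / 2 / 2 by rewrite !divr_gt0// normr_gt0.
have [z Sz yz] := Sy _ e0; have [n zd] := d_dense _ _ Sz e0.
have yd : `|y - d n| < `|y| / 2.
  rewrite -(subrKA z) (le_lt_trans (ler_normD _ _))//.
  by rewrite [ltRHS]splitr ltrD.
suff : `|y| < `|y| by rewrite ltxx.
rewrite -{1}(subrK (d n) y) (le_lt_trans (ler_normD _ _))//.
rewrite [ltRHS]splitr ltrD// (le_lt_trans _ yd)//.
by rewrite -f_norming distrC -[f n (d n)]subr0 -(fy0 n) -linearB f_le.
Qed.

Let closedC : closed C.
Proof.
apply: closedI; first exact: closed_closure.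
move=> y /closure_normP cy n; apply/ler_addgt0Pr => e e0.
(* Half of [e] suffices because [p n] is at most twice the norm. *)
have [z /(_ n) pz yz] := cy _ (divr_gt0 e0 (ltr0Sn K 1)).
rewrite -(subrK z y) addrC (le_trans (pD _ _ _))// lerD//.
by rewrite (le_trans (p_le _ _))// -mulr_natr -ler_pdivlMr// ltW.
Qed.

Let abs_convexC : absolutely_convex C.
Proof.
split.
- exists 0; split=> // n.
  by rewrite /p linear0 !normr0 mulr0 addr0.
- move=> y z l /set_mem[Sy py] /set_mem[Sz pz]; apply/mem_set; split.
    apply: closureS_linear => //; exact: closureSZ.
  move=> n; apply: le_trans (pD _ _ _) _; rewrite !pZ.
  have l0 : 0 <= l%:num by [].
  have l1 : 0 <= 1 - l%:num by rewrite subr_ge0.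
  rewrite (ger0_norm l0) (ger0_norm l1) -[leRHS](subrKC l%:num).
  by rewrite lerD// ler_piMr.
- move=> a y a1 [Sy py]; split; first exact: closureSZ.
  by move=> n; rewrite pZ mulr_ile1// (le_trans _ (p_ge n y)).
Qed.

Let norm_lt1 e : C e -> `|e| < 1.
Proof.
move=> [Se pe]; have [->|e0] := eqVneq e 0; first by rewrite normr0.
have [n fn0] : exists n, f n e != 0.
  apply: contrapT => /forallNP fe; move/eqP: e0; apply.
  by apply: functionals_total => // n; have /negP/negPn/eqP := fe n.
apply: lt_le_trans (pe n); rewrite ltrDl mulr_gt0 ?invr_gt0//.
by rewrite normr_gt0.
Qed.

(** A nonzero [y] in the span killed by [f 0], ..., [f N] has [p n y <= (1 + w) |y|] for all [n],
    where [w = N.+1%:R^-1]. Scaling the right side to 1 puts it in [C] with norm [(1 + w)^-1]. *)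
Let norm_approx1 r : r < 1 -> exists2 y, C y & r < `|y|.
Proof.
move=> r1; have [N Nr] := archiK (1 - r) ltac:(by rewrite subr_gt0).
have [c [y0 fy0]] := common_kernel _ _ _ f N.+1 free_x.
set y := \sum_(i < _) _ in y0 fy0.
have w0 : 0 < 1 + N.+1%:R^-1 :> K by rewrite ltr_wpDr.
have ny : 0 < `|y| by rewrite normr_gt0.
exists (((1 + N.+1%:R^-1) * `|y|)^-1 *: y).
  split=> [|n]; first by apply/closureSZ/subset_closure; eexists; eexists.
  rewrite pZ ger0_norm ?invr_ge0 ?mulr_ge0 ?(ltW w0) ?(ltW ny)//.
  rewrite ler_pdivrMl ?mulr_gt0// mulr1.
  have [nN|Nn] := ltnP n N.+1.
    by rewrite /p fy0// normr0 mulr0 addr0 ler_peMl// lerDl.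
  rewrite /p mulrDl mul1r lerD2l ler_pM//.
  by rewrite lef_pV2 ?posrE// ler_nat ltnS ltnW.
rewrite normrZ ger0_norm ?invr_ge0 ?mulr_ge0 ?(ltW w0) ?(ltW ny)//.
rewrite invfM mulfVK ?gt_eqF//.
(* With [w = N.+1%:R^-1]: [r < 1 - w <= (1 + w)^-1], the latter since
   [(1 - w) * (1 + w) = 1 - w ^ 2 <= 1]. *)
rewrite (@lt_le_trans _ _ (1 - N.+1%:R^-1))// ?ltrBrDl -?ltrBrDr//.
rewrite -[leRHS]div1r ler_pdivlMr// -subr_sqr expr1n.
by rewrite gerBl exprn_ge0.
Qed.

Lemma exists_nonremotal : exists C : set Y,
  [/\ closed C, absolutely_convex C, C `<=` @closed_unit_ball K Y
    & ~ remotal C 0].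
Proof.
exists C; split => //.
- by move=> y [_ /(_ 0%N)]; exact: le_trans.
- move=> [e Ce [ub _]]; have [y Cy ey] := norm_approx1 _ (norm_lt1 _ Ce).
  have : `|0 - y| <= `|0 - e| by apply: ub; exists y.
  by rewrite !sub0r !normrN => /(lt_le_trans ey); rewrite ltxx.
Qed.

End NonRemotal.

(** * Reduction to three properties of the scalars and the norm *)

Lemma dense_combinations (K : numFieldType) (Y : normedModType K)
    (q : nat -> K) (x : nat -> Y) :
  (forall a e : K, 0 < e -> exists n, `|a - q n| < e) ->
  exists d : nat -> Y, forall n (c : nat -> K) (e : K), 0 < e ->
    exists k, `|\sum_(i < n) c i *: x i - d k| < e.
Proof.
move=> qdense.
(* The index [k] codes a finite list of indices into [q], read as coefficients; the value 0 at
   non-codes is arbitrary. *)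
exists (fun k => if unpickle k is Some s then
  \sum_(i < size s) q (nth 0%N s i) *: x i else 0) => n c e e0.
(* With [n.+1] in place of [n], the [n] errors total at most [e * n / n.+1], strictly below [e] even
   for [n = 0]. *)
have en : 0 < e / n.+1%:R by rewrite divr_gt0.
have xi i : 0 < `|x i| + 1 by rewrite ltr_wpDl.
have /choice[k kP] i : exists k, `|c i - q k| < e / n.+1%:R / (`|x i| + 1).
  by apply: qdense; rewrite divr_gt0.
exists (pickle (mkseq k n)); rewrite pickleK size_mkseq -sumrB.
rewrite (@le_lt_trans _ _ (\sum_(i < n) e / n.+1%:R))//.
  apply: le_trans (ler_norm_sum _ _ _) _; apply: ler_sum => i _.
  rewrite nth_mkseq// -scalerBl normrZ.
  have := kP i; rewrite ltr_pdivlMr// => /ltW; apply: le_trans.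
  by rewrite ler_wpM2l// lerDl.
rewrite sumr_const card_ord -[ltLHS]mulr_natr -mulrA -[ltRHS]mulr1 ltr_pM2l//.
by rewrite mulrC ltr_pdivrMr// mul1r ltr_nat.
Qed.

(** The hypotheses collect what the construction asks for: separable and Archimedean scalars, and
    norming functionals. *)
Lemma nonremotal_of_norming (K : numFieldType) (Y : normedModType K)
    (q : nat -> K) :
  (forall a e : K, 0 < e -> exists n, `|a - q n| < e) ->
  (forall e : K, 0 < e -> exists n, n.+1%:R^-1 < e) ->
  (forall y : Y, exists f : {scalar Y},
    (forall z, `|f z| <= `|z|) /\ `|f y| = `|y|) ->
  infinite_dimensional Y -> exists C : set Y,
  [/\ closed C, absolutely_convex C, C `<=` @closed_unit_ball K Y
    & ~ remotal C 0].
Proof.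
move=> qdense archiK norming /infinite_dimensional_free_seq[x free_x].
have [d d_dense] := dense_combinations _ _ _ x qdense.
have /choice[f fP] n := norming (d n).
apply: (exists_nonremotal x f d) => //.
- by move=> n y; have [] := fP n.
- by move=> n; have [] := fP n.
- by move=> _ e [n [c ->]]; exact: d_dense.
Qed.

(** * Real and complex scalars *)

Section Scalars.
Context {R : realType}.

Definition rat_seq (n : nat) : R :=
  if unpickle n is Some r then ratr (r : rat) else 0.

Lemma rat_seq_dense (a e : R) : 0 < e -> exists n, `|a - rat_seq n| < e.
Proof.
move=> e0; have [|r] := @rat_in_itvoo R (a - e) (a + e); first lra.
rewrite in_itv /= => /andP[ar ra]; exists (pickle r).
by rewrite /rat_seq pickleK ltr_norml; apply/andP; split; lra.
Qed.

Lemma inv_nat_lt (e : R) : 0 < e -> exists n, n.+1%:R^-1 < e.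
Proof.
move=> e0; exists (Num.bound e^-1); rewrite invf_plt ?posrE//.
have : 0 <= e^-1 by rewrite invr_ge0 ltW.
by move=> /archi_boundP/lt_trans; apply; rewrite ltr_nat.
Qed.

Lemma real_norming (Y : normedModType R) (y : Y) :
  exists f : {scalar Y}, (forall z, `|f z| <= `|z|) /\ `|f y| = `|y|.
Proof.
have sub : sublinear (idfun : {rmorphism R -> R}) (fun y : Y => `|y|).
  split=> [|t x t0]; first exact: ler_normD.
  by rewrite normrZ gtr0_norm.
have [f [fD fZ f_le fy]] := hahn_banach _ _ y sub.
have flin : scalar f by move=> a u v; rewrite fD fZ.
pose F : {scalar Y} := HB.pack f (GRing.isLinear.Build _ _ _ _ f flin).
exists F; split=> [z|]; last by rewrite /= fy normr_id.
rewrite ler_norml f_le andbT lerNl.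
by rewrite -(linearN F) /= (le_trans (f_le _))// normrN.
Qed.

Definition complex_rat_seq (n : nat) : R[i] :=
  if unpickle n is Some (r, s) then ratr (r : rat) +i* ratr (s : rat) else 0.

Lemma complex_rat_seq_dense (a e : R[i]) :
  0 < e -> exists n, `|a - complex_rat_seq n| < e.
Proof.
(* In [R[i]], [0 < e] forces the imaginary part of [e] to vanish; the real part is then split
   between the two coordinates. *)
case: a e => a1 a2 [e1 e2]; rewrite ltcE /= => /andP[/eqP-> e0].
have e20 : 0 < e1 / 2 by rewrite divr_gt0.
have [|r] := @rat_in_itvoo R (a1 - e1 / 2) (a1 + e1 / 2).
  lra.
rewrite in_itv /= => rP.
have [|s] := @rat_in_itvoo R (a2 - e1 / 2) (a2 + e1 / 2).
  lra.
rewrite in_itv /= => sP.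
have normR (t : R) : `|t%:C| = `|t|%:C.
  by rewrite normc_def /= expr0n /= addr0 sqrtr_sqr.
have normi : `|'i : R[i]| = 1.
  by rewrite normc_def /= expr0n /= add0r expr1n sqrtr1.
exists (pickle (r, s)); rewrite /complex_rat_seq pickleK.
rewrite [_ - _]complexE /=.
rewrite (le_lt_trans (ler_normD _ _))// normrM normi mul1r !normR -rmorphD ltcR.
rewrite [ltRHS]splitr ltrD// ltr_norml; apply/andP; split; lra.
Qed.

Lemma inv_nat_ltC (e : R[i]) : 0 < e -> exists n, n.+1%:R^-1 < e.
Proof.
case: e => e1 e2; rewrite ltcE /= => /andP[/eqP-> e0].
have [n ne] := inv_nat_lt e1 e0; exists n.
by rewrite -(rmorph_nat (real_complex R)) -fmorphV ltcR.
Qed.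

(** A real-linear [f] dominated by the norm is the real part of the complex-linear
    [g z = f z - i f (i z)], which inherits the bound. *)
Lemma complex_norming (Y : normedModType R[i]) (y : Y) :
  exists f : {scalar Y}, (forall z, `|f z| <= `|z|) /\ `|f y| = `|y|.
Proof.
have normE (z : Y) : (complex.Re `|z|)%:C = `|z| by rewrite RRe_real.
have sub : sublinear (real_complex R) (fun y : Y => complex.Re `|y|).
  split=> [u v|t x t0].
    by rewrite -lecR rmorphD /= !normE ler_normD.
  apply: complexI; rewrite rmorphM /= !normE normrZ.
  by rewrite ger0_norm// lecR ltW.
have [f [fD fZ f_le fy]] := hahn_banach _ _ y sub.
pose g z : R[i] := f z +i* (- f ('i *: z)).
have ReZ (c : R[i]) (z : Y) : c *: z =
    real_complex R (complex.Re c) *: z + real_complex R (complex.Im c) *: ('i *: z).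
  by rewrite {1}[c]complexE scalerDl scalerA mulrC.
have iiZ (z : Y) : 'i *: ('i *: z) = real_complex R (-1) *: z.
  by rewrite scalerA -expr2 sqr_i rmorphN1.
have glin : scalar g.
  move=> c u v; rewrite /g scalerDr !fD scalerA mulrC -scalerA.
  rewrite (ReZ c u) (ReZ c ('i *: u)) !fD !fZ iiZ fZ.
  rewrite [c in RHS]complexE.
  apply/eqP; rewrite eq_complex /=; apply/andP; split; apply/eqP; ring.
pose G : {scalar Y} := HB.pack g (GRing.isLinear.Build _ _ _ _ g glin).
have G_le z : `|G z| <= `|z|.
  have [->|g0] := eqVneq (G z) 0; first by rewrite normr0.
  (* The unimodular [u] rotates [G z] onto [|G z|], so [|G z| = f (u *: z) <= |u *: z| = |z|]. *)
  pose u := `|G z| / G z.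
  have u1 : `|u| = 1 by rewrite normf_div normr_id divff// normr_eq0.
  have fu : f (u *: z) = complex.Re `|G z|.
    by rewrite -[`|G z|](divfK g0) -/u; have -> : u * G z = G (u *: z) by rewrite linearZ.
  rewrite -normE -[leLHS]RRe_real ?normr_real// -fu lecR.
  by rewrite (le_trans (f_le _))// normrZ u1 mul1r.
exists G; split=> //; apply/le_anti; rewrite G_le /=.
(* Here [|y| = f y] is the real part of [G y], hence at most [|G y|]. *)
rewrite -normE -fy (le_trans _ (normc_ge_Re (G y)))//.
by rewrite lecR ler_norm.
Qed.

End Scalars.

Theorem corollary4p6 (R : realType) :
  (forall Y : completeNormedModType R, infinite_dimensional Y ->
     exists C : set Y,
       [/\ closed C, absolutely_convex C, C `<=` @closed_unit_ball R Y
         & ~ remotal C 0])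
  /\
  (forall Y : completeNormedModType R[i], infinite_dimensional Y ->
     exists C : set Y,
       [/\ closed C, absolutely_convex C, C `<=` @closed_unit_ball R[i] Y
         & ~ remotal C 0]).
Proof.
split=> Y.
- exact: nonremotal_of_norming rat_seq_dense inv_nat_lt (real_norming Y).
- exact: nonremotal_of_norming complex_rat_seq_dense inv_nat_ltC
    (complex_norming Y).
Qed.
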